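(* For each integer $N \geq 5$, let $$ M = M(N) = \begin{cases} 2N+3, & \text{if } N \equiv -1 \bmod 12,\\ 2N+1, & \text{if } N \equiv 0, 1, 3, 5, 7, \text{ or } 9 \bmod 12,\\ 2N, & \text{if } N \equiv 2, 4, 6, 8, \text{ or } 10 \bmod 12. \end{cases} $$ Then for each integer $N \geq 5$ we have $$t_N^{(N+1)}(n) = \Omega(n^{\tau_N}) \quad \text{as } n \to \infty \text{ (with } N \text{ fixed)},$$ where $\tau_N = \log_N M(N)$.
   Context: All points and lines are in the real plane $\mathbf{R}^2$. For a finite set $S$ of points in the plane and an integer $k\ge 2$, $t_k(S)$ denotes the number of lines meeting $S$ in exactly $k$ points, and $T_k(S)=\sum_{k'\ge k} t_{k'}(S)$ denotes the number of lines meeting $S$ in at least $k$ points. For $r>k$ and a positive integer $n$, $t_k^{(r)}(n)$ denotes the maximum of $t_k(S)$ over all sets $S$ of $n$ points in the plane with $T_r(S)=0$, i.e. such that no line contains $r$ or more points of $S$. In particular $t_N^{(N+1)}(n)$ is the largest number of lines containing exactly $N$ points of an $n$-point plane set having no $N+1$ collinear points. The notation $f(n)=\Omega(g(n))$ means there is a constant $c>0$ (which may depend on $N$) with $f(n)\ge c\,g(n)$ for all sufficiently large $n$. *)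

(* Defs.v *)
From mathcomp Require Export all_boot all_order all_algebra.
From mathcomp Require Export finmap.
From mathcomp Require Export boolp classical_sets functions cardinality reals.
From mathcomp Require Export topology normedtype sequences exp.
From mathcomp Require Import ring.

Set Implicit Arguments.
Unset Strict Implicit.
Unset Printing Implicit Defensive.

Export Order.TTheory GRing.Theory Num.Theory.
Export numFieldNormedType.Exports.

Local Open Scope classical_set_scope.
Local Open Scope fset_scope.
Local Open Scope ring_scope.

Definition is_line (R : realType) (l : set (R * R)) : Prop :=
  exists a b c : R,
    ((a != 0) || (b != 0)) /\ l = [set p | a * p.1 + b * p.2 = c].

Definition points_on (R : realType) (S : {fset R * R}) (l : set (R * R)) :
    {fset R * R} :=
  [fset p in S | p \in l].

Definition lines_meeting (R : realType) (k : nat) (S : {fset R * R}) :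
    set (set (R * R)) :=
  [set l | is_line l /\ #|` points_on S l| = k].

(* [fset_set] sends infinite sets to [fset0]; for [2 <= k] this does not occur,
   by [finite_lines_meeting] below. *)
Definition t (R : realType) (k : nat) (S : {fset R * R}) : nat :=
  #|` fset_set (lines_meeting k S)|.

(* The sum over all k' >= k is cut off at #|S|: [t k' S = 0] for k' > #|S|;
   see [T_eq0]. *)
Definition T (R : realType) (k : nat) (S : {fset R * R}) : nat :=
  (\sum_(k <= k' < #|` S|.+1) t k' S)%N.

Definition admissible (R : realType) (r n : nat) : set {fset R * R} :=
  [set S | #|` S| = n /\ T r S = 0%N].

Definition is_t_max (R : realType) (k r n m : nat) : Prop :=
  (exists2 S : {fset R * R}, admissible r n S & t k S = m) /\
  (forall S : {fset R * R}, admissible r n S -> (t k S <= m)%N).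

(* The default value 0 is used only if there is no
   maximum; see [t_maxP]. *)
Definition t_max (R : realType) (k r n : nat) : nat :=
  xget 0%N [set m | is_t_max R k r n m].

Lemma line_through2 (R : realType) (l : set (R * R)) (p q : R * R) :
  is_line l -> l p -> l q -> p != q ->
  l = [set z | (z.1 - p.1) * (q.2 - p.2) = (z.2 - p.2) * (q.1 - p.1)].
Proof.
move=> [a [b [c [ab0 ->]]]] /= lp lq pq.
have uv0 : (q.1 - p.1 != 0) || (q.2 - p.2 != 0).
  apply: contraNT pq; rewrite negb_or !negbK !subr_eq0 => /andP[/eqP e1 /eqP e2].
  by rewrite (surjective_pairing p) (surjective_pairing q) e1 e2.
have H : a * (q.1 - p.1) + b * (q.2 - p.2) = 0.
  have -> : a * (q.1 - p.1) + b * (q.2 - p.2)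
    = (a * q.1 + b * q.2) - (a * p.1 + b * p.2) by ring.
  by rewrite lp lq subrr.
apply/seteqP; split => z /= hz; apply/eqP.
  rewrite -subr_eq0.
  have H2 : a * (z.1 - p.1) + b * (z.2 - p.2) = 0.
    have -> : a * (z.1 - p.1) + b * (z.2 - p.2)
      = (a * z.1 + b * z.2) - (a * p.1 + b * p.2) by ring.
    by rewrite lp hz subrr.
  set d := _ - _ * (q.1 - p.1).
  have ha : a * d = 0.
    have -> : a * d = (q.2 - p.2) * (a * (z.1 - p.1) + b * (z.2 - p.2))
      - (z.2 - p.2) * (a * (q.1 - p.1) + b * (q.2 - p.2)) by rewrite /d; ring.
    by rewrite H H2 !mulr0 subrr.
  have hb : b * d = 0.
    have -> : b * d = (z.1 - p.1) * (a * (q.1 - p.1) + b * (q.2 - p.2))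
      - (q.1 - p.1) * (a * (z.1 - p.1) + b * (z.2 - p.2)) by rewrite /d; ring.
    by rewrite H H2 !mulr0 subrr.
  by case/orP: ab0 => h; [move/eqP: ha|move/eqP: hb]; rewrite mulf_eq0 (negPf h).
rewrite -subr_eq0 -lp.
set d := _ - (_ + _).
have hu : (q.1 - p.1) * d = 0.
  have -> : (q.1 - p.1) * d =
     (z.1 - p.1) * (a * (q.1 - p.1) + b * (q.2 - p.2))
     - b * ((z.1 - p.1) * (q.2 - p.2) - (z.2 - p.2) * (q.1 - p.1))
    by rewrite /d; ring.
  by rewrite H hz subrr !mulr0 subrr.
have hv : (q.2 - p.2) * d = 0.
  have -> : (q.2 - p.2) * d =
     (z.2 - p.2) * (a * (q.1 - p.1) + b * (q.2 - p.2))
     + a * ((z.1 - p.1) * (q.2 - p.2) - (z.2 - p.2) * (q.1 - p.1))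
    by rewrite /d; ring.
  by rewrite H hz subrr !mulr0 addr0.
by case/orP: uv0 => h; [move/eqP: hu|move/eqP: hv]; rewrite mulf_eq0 (negPf h).
Qed.

Lemma in_points_on (R : realType) (S : {fset R * R}) (l : set (R * R)) p :
  (p \in points_on S l) = (p \in S) && (p \in l).
Proof. by rewrite !inE. Qed.

Lemma points_on_inj (R : realType) (k : nat) (S : {fset R * R}) : (2 <= k)%N ->
  {in lines_meeting k S &, injective (points_on S)}.
Proof.
move=> k2 l1 l2 /[!inE] -[L1 c1] [L2 c2] e.
have [p pS] : exists p, p \in points_on S l1.
  by apply/fset0Pn; rewrite -cardfs_gt0 c1 (leq_trans _ k2).
have [q qS] : exists q, q \in points_on S l1 `\ p.
  apply/fset0Pn; rewrite -cardfs_gt0; move: k2.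
  by rewrite -c1 (cardfsD1 p) pS.
move: qS; rewrite in_fsetD1 => /andP[qp qS].
move: (pS) (qS); rewrite e !in_points_on => /andP[_ p2] /andP[_ q2].
move: pS qS; rewrite !in_points_on => /andP[_ p1] /andP[_ q1].
rewrite !inE in p1 q1 p2 q2; rewrite eq_sym in qp.
by rewrite (line_through2 L1 p1 q1 qp) (line_through2 L2 p2 q2 qp).
Qed.

Lemma lines_meeting_image (R : realType) (k : nat) (S : {fset R * R}) :
  ([set points_on S l | l in lines_meeting k S] `<=` [set` fpowerset S])%classic.
Proof.
move=> _ [l _ <-] /=; rewrite fpowersetE.
by apply/fsubsetP => p; rewrite in_points_on => /andP[].
Qed.

Lemma finite_lines_meeting (R : realType) (k : nat) (S : {fset R * R}) :
  (2 <= k)%N -> finite_set (lines_meeting k S).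
Proof.
move=> k2.
have : ([set points_on S l | l in lines_meeting k S]%classic #= lines_meeting k S)%card.
  by apply: inj_card_eq => x y; exact: points_on_inj.
move=> /eq_finite_set <-.
exact: finite_subfset (@lines_meeting_image R k S).
Qed.

Lemma t_le (R : realType) (k : nat) (S : {fset R * R}) :
  (2 <= k)%N -> (t k S <= 2 ^ #|` S|)%N.
Proof.
move=> k2; rewrite -card_fpowerset /t.
have fl := finite_lines_meeting S k2.
have -> : #|` fset_set (lines_meeting k S)|
  = #|` points_on S @` fset_set (lines_meeting k S)|.
  rewrite card_in_imfset//= => x y; rewrite !in_fset_set//.
  exact: points_on_inj.
apply: fsubset_leq_card; apply/fsubsetP => _ /imfsetP[l _ ->].
by rewrite fpowersetE; apply/fsubsetP => p; rewrite in_points_on => /andP[].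
Qed.

Lemma T_eq0 (R : realType) (r : nat) (S : {fset R * R}) : (2 <= r)%N ->
  T r S = 0%N <-> forall l, is_line l -> (#|` points_on S l| < r)%N.
Proof.
move=> r2; split=> [/eqP T0 l Ll|lS].
  rewrite ltnNge; apply/negP => rl.
  move: T0; rewrite /T sum_nat_seq_eq0 => /allP/(_ #|` points_on S l|).
  have lS : (#|` points_on S l| <= #|` S|)%N.
    apply: fsubset_leq_card; apply/fsubsetP => p.
    by rewrite in_points_on => /andP[].
  rewrite mem_index_iota rl ltnS lS => /(_ isT) /=.
  rewrite cardfs_eq0 => /eqP/fsetP/(_ l).
  rewrite in_fset_set ?in_fset0; last first.
    by apply: finite_lines_meeting; exact: leq_trans rl.
  by move/negbT/negP; apply; rewrite inE.
rewrite /T big_nat_cond big1// => k /andP[/andP[rk _] _].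
apply/eqP; rewrite cardfs_eq0; apply/eqP/fsetP => l.
rewrite in_fset_set ?in_fset0; last first.
  by apply: finite_lines_meeting; exact: leq_trans rk.
apply/negbTE/negP; rewrite inE => -[Ll c].
by have := lS _ Ll; rewrite c ltnNge rk.
Qed.

Lemma admissible_nonempty (R : realType) (r n : nat) :
  (3 <= r)%N -> exists S : {fset R * R}, admissible r n S.
Proof.
move=> r3; pose f (i : 'I_n) : R * R := (i%:R, i%:R ^+ 2).
have f_inj : injective f.
  by move=> i j [/eqP]; rewrite eqr_nat => /eqP ij _; exact: val_inj.
exists [fset f i | i : 'I_n]; split.
  by rewrite card_imfset//= size_enum_ord.
apply/T_eq0 => [|l [a [b [c [ab0 ->]]]]]; first exact: leq_trans r3.
apply: leq_trans r3.
pose P : {poly R} := Poly [:: - c; a; b].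
have P0 : P != 0.
  apply/eqP => /polyP P0; have := P0 1%N; have := P0 2%N.
  by rewrite !coef_Poly /= !coef0 => b0 a0; rewrite a0 b0 !eqxx in ab0.
pose s := [seq x.1 | x <- points_on [fset f i | i : 'I_n] 
   [set p | a * p.1 + b * p.2 = c]].
have -> : #|` points_on [fset f i | i : 'I_n] 
   [set p | a * p.1 + b * p.2 = c]| = size s by rewrite size_map.
apply: leq_trans (max_poly_roots P0 _ _) (size_Poly _).
  apply/allP => _ /mapP[p + ->].
  rewrite in_points_on => /andP[/imfsetP[i _ ->]]; rewrite inE /= => e.
  rewrite /root horner_Poly /= -[X in _ - X]e; apply/eqP; ring.
rewrite map_inj_in_uniq ?fset_uniq// => p q.
rewrite !in_points_on => /andP[/imfsetP[i _ ->] _] /andP[/imfsetP[j _ ->] _].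
by rewrite /f /= => ->.
Qed.

Lemma t_maxP (R : realType) (k r n : nat) : (2 <= k)%N -> (3 <= r)%N ->
  is_t_max R k r n (t_max R k r n).
Proof.
move=> k2 r3; suff : exists m, is_t_max R k r n m by exact: xgetPex.
pose P m := `[< exists2 S : {fset R * R}, admissible r n S & t k S = m >].
have exP : exists m, P m.
  have [S AS] := admissible_nonempty R n r3.
  by exists (t k S); apply/asboolP; exists S.
have ubP m : P m -> (m <= 2 ^ n)%N.
  by move=> /asboolP[S [<- _] <-]; exact: t_le.
case: (ex_maxnP exP ubP) => m /asboolP Pm mmax.
by exists m; split=> // S AS; apply: mmax; apply/asboolP; exists S.
Qed.

Definition M (N : nat) : nat :=
  if (N %% 12 == 11)%N then (2 * N + 3)%N
  else if (N %% 12)%N \in [:: 0; 1; 3; 5; 7; 9]%N then (2 * N + 1)%N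
  else (2 * N)%N.

Definition tau (R : realType) (N : nat) : R := ln (M N)%:R / ln N%:R.

(* Main.v *)
Require Import Defs.
From mathcomp Require Import ring lra zify.

Set Implicit Arguments.
Unset Strict Implicit.
Unset Printing Implicit Defensive.

Local Open Scope classical_set_scope.
Local Open Scope ring_scope.

(** The exponent [tau_N] is at most [3 / 2], because [M N ^ 2 <= N ^ 3] for
    [N >= 5]; it is therefore enough to find point sets with no [N + 1] points
    on a line and with at least a constant times [n ^ (3 / 2)] lines through
    [N] of the [n] points.

    Such sets are plane projections of subsets of a space of large dimension
    [d + 1], an idea of Solymosi and Stojakovic.  The points are the pairs
    [(t, x)] with height [t < N] and [x] an integer vector of dimension [d],
    with coordinates in a fixed range and [|x|^2 = r t].  A line that is not
    contained in a slice [t = constant] meets each of the [N] slices at most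
    once, and a line inside a slice meets a sphere, hence at most two points;
    so no line carries [N + 1] of the points ([slices_of_spheres]).

    Rich lines come from arithmetic progressions: the points [(t, a + t s)] with
    [t < N] lie on a line, and the condition
    [|a + t s|^2 = |a|^2 + 2 t (a . s) + t^2 |s|^2 = r t] depends only on the
    three numbers [|a|^2], [a . s] and [|s|^2].  These take polynomially many
    values in [d], so by the pigeonhole principle some choice of them, which
    fixes [r], is shared by a fraction of the pairs [(a, s)] that decreases only
    polynomially ([equinormal_progressions]).  With [W = 32 N] and coordinates
    below [W ^ 2] there are at most [N W ^ (2 d)] points, and at least
    [W ^ (3 d - 12)] pairs [(a, s)] survive ([many_rich_lines]), whence the
    exponent [3 / 2].

    A generic linear projection to the plane creates no new collinear triple
    ([generic_projection]), and adding points in general position reaches every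
    cardinality [n] without spoiling a rich line ([add_generic_points]). *)

(** * Generic choices *)

(** A nonzero polynomial has finitely many roots, so every finite list of
    genericity conditions of the form [p.[x] != 0] can be met at once. *)
Lemma avoid_roots (R : numDomainType) (ps : seq {poly R}) :
  0 \notin ps -> exists x : R, forall p, p \in ps -> p.[x] != 0.
Proof.
move=> ps0; pose P := \prod_(p <- ps) p.
have P0 : P != 0.
  rewrite prodf_seq_neq0; apply/allP => p pps /=.
  by apply: contraNneq ps0 => <-.
pose rs : seq R := [seq i%:R | i <- iota 0 (size P)].
have [x _ xP] : exists2 x, x \in rs & ~~ root P x.
  apply/hasP; rewrite has_predC; apply/negP => rsP.
  have /(max_poly_roots P0 rsP) : uniq rs.
    rewrite map_inj_uniq ?iota_uniq// => i j /eqP.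
    by rewrite eqr_nat => /eqP.
  by rewrite size_map size_iota ltnn.
exists x => p pps; apply: contra xP => /eqP px.
rewrite rootE /P horner_prod (perm_big _ (perm_to_rem pps)).
by rewrite big_cons /= px mul0r.
Qed.

Definition line_through (R : realType) (p q : R * R) : set (R * R) :=
  [set z | (z.1 - p.1) * (q.2 - p.2) = (z.2 - p.2) * (q.1 - p.1)].

Lemma is_line_line_through (R : realType) (p q : R * R) :
  p != q -> is_line (line_through p q).
Proof.
move=> pq; exists (q.2 - p.2), (p.1 - q.1),
  (p.1 * (q.2 - p.2) - p.2 * (q.1 - p.1)); split.
  apply: contraNT pq; rewrite negb_or !negbK !subr_eq0 => /andP[/eqP e1 /eqP e2].
  by rewrite (surjective_pairing p) (surjective_pairing q) e1 e2.
by apply/seteqP; split => z /=; rewrite /line_through /=; lra.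
Qed.

(** Polynomials stand for vectors, and evaluating at a point of the real line is
    a linear form that becomes generic with the point; this keeps each of the
    two choices a matter of roots of univariate polynomials.  The first point
    [xi] separates the vectors, so [U - P] and [Q - P] do not both vanish at
    [xi]; the combination of the two that vanishes at [xi] is zero exactly when
    they are proportional, and the second point [eta] is not a root of any
    nonzero combination of this kind. *)
Lemma generic_projection (R : realType) (s : seq {poly R}) :
  exists xi eta : R,
    {in s &, injective (fun P => (P.[xi], P.[eta]))} /\
    {in s & &, forall P Q U, P != Q ->
      line_through (P.[xi], P.[eta]) (Q.[xi], Q.[eta]) (U.[xi], U.[eta]) ->
      exists l, U = P + l *: (Q - P)}.
Proof.
have [|xi hxi] := @avoid_roots R
   [seq P <- [seq P - Q | P <- s, Q <- s] | P != 0].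
  by rewrite mem_filter eqxx.
have xiP : {in s &, forall P Q, P != Q -> P.[xi] - Q.[xi] != 0}.
  move=> P Q Ps Qs PQ; rewrite -hornerN -hornerD.
  apply: hxi; rewrite mem_filter subr_eq0 PQ /=.
  by apply/allpairsP; exists (P, Q).
(* [c P Q U] vanishes at [xi]; it is zero only if [U - P] and [Q - P] are
   proportional. *)
pose c (P Q U : {poly R}) := (Q - P).[xi] *: (U - P) - (U - P).[xi] *: (Q - P).
pose cs := [seq c P u.1 u.2 | P <- s, u <- [seq (Q, U) | Q <- s, U <- s]].
have [|eta heta] := @avoid_roots R [seq P <- cs | P != 0].
  by rewrite mem_filter eqxx.
exists xi, eta; split.
  move=> P Q Ps Qs [e _]; apply/eqP; apply: contraT => /(xiP _ _ Ps Qs).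
  by rewrite e subrr eqxx.
move=> P Q U Ps Qs Us PQ h.
have c0 : c P Q U = 0.
  apply/eqP; apply: contraT => c0.
  have /heta : c P Q U \in [seq P <- cs | P != 0].
    rewrite mem_filter c0; apply/allpairsP; exists (P, (Q, U)).
    by split=> //; apply/allpairsP; exists (Q, U).
  move: h; rewrite /line_through /c /= !hornerE => h.
  by rewrite [X in X != 0](_ : _ = 0) ?eqxx//; lra.
have := xiP _ _ Qs Ps; rewrite eq_sym PQ => /(_ isT) d0.
exists ((U.[xi] - P.[xi]) / (Q.[xi] - P.[xi])).
move/eqP: c0; rewrite /c !hornerE subr_eq0 => /eqP c0.
by rewrite mulrC -scalerA -c0 scalerA mulVf// scale1r addrC subrK.
Qed.

(** The point is sought on a parabola, which contains no line: membership in a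
    line spanned by [S] is then a nontrivial quadratic equation. *)
Lemma generic_point (R : realType) (S : {fset R * R}) :
  exists2 p : R * R, p \notin S &
    forall l, is_line l -> p \in l -> (#|` points_on S l| <= 1)%N.
Proof.
pose c (p q : R * R) : {poly R} :=
  ('X - p.1%:P) * (q.2 - p.2)%:P - ('X^2 - p.2%:P) * (q.1 - p.1)%:P.
pose cs := [seq c u.1 u.2 | u <- [seq (p, q) | p <- S, q <- S]].
have [|x hx] := @avoid_roots R
   ([seq 'X - p.1%:P | p <- S] ++ [seq P <- cs | P != 0]).
  rewrite mem_cat mem_filter eqxx orbF; apply/mapP => -[p _ /esym/eqP].
  by rewrite polyXsubC_eq0.
exists (x, x ^+ 2).
  apply/negP => xS; have /hx : 'X - x%:P \in [seq 'X - p.1%:P | p <- S] ++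
       [seq P <- cs | P != 0].
    by rewrite mem_cat; apply/orP; left; apply/mapP; exists (x, x ^+ 2).
  by rewrite !hornerE subrr eqxx.
move=> l Ll xl; rewrite leqNgt; apply/negP => two.
have [p pS] : exists p, p \in points_on S l.
  by apply/fset0Pn; rewrite -cardfs_gt0 (leq_trans _ two).
have [q] : exists q, q \in (points_on S l `\ p)%fset.
  by apply/fset0Pn; rewrite -cardfs_gt0; move: two; rewrite (cardfsD1 p) pS.
rewrite in_fsetD1 => /andP[qp].
move: pS; rewrite !in_points_on => /andP[pS pl] /andP[qS ql].
rewrite eq_sym in qp; rewrite !inE in pl ql xl.
move: xl; rewrite (line_through2 Ll pl ql qp) /= => xl.
have /hx : c p q \in [seq 'X - p.1%:P | p <- S] ++ [seq P <- cs | P != 0].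
  rewrite mem_cat; apply/orP; right; rewrite mem_filter; apply/andP; split.
    apply: contraNneq qp => /polyP c0; have := c0 1%N; have := c0 2%N.
    rewrite /c !(coefB, coefMC, coefX, coefXn, coefC, coef0) /= => h2 h1.
    rewrite (surjective_pairing p) (surjective_pairing q).
    by apply/eqP; congr pair; lra.
  by apply/mapP; exists (p, q) => //; apply/allpairsP; exists (p, q).
by rewrite /c !hornerE [X in X != 0](_ : _ = 0) ?eqxx//; lra.
Qed.

(** An added point lies on no line through two earlier points, so it leaves
    all rich lines untouched and new lines get at most two points. *)
Lemma add_generic_points (R : realType) (k r : nat) (S : {fset R * R})
  (n : nat) :
  (2 <= k)%N -> (3 <= r)%N -> T r S = 0%N -> (#|` S| <= n)%N ->
  exists2 S' : {fset R * R}, admissible r n S' & (t k S <= t k S')%N.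
Proof.
move=> k2 r3 TS; elim: n => [|n IHn] cS.
  by exists S => //; split=> //; apply/eqP; rewrite -leqn0.
move: cS; rewrite leq_eqVlt => /orP[/eqP cS|]; first by exists S.
rewrite ltnS => /IHn[S1 [cS1 TS1] tS1].
have [p pS1 hp] := generic_point S1.
have on_off l : p \notin l -> points_on (p |` S1)%fset l = points_on S1 l.
  move=> pl; apply/fsetP => q; rewrite !in_points_on in_fset1U.
  by case: eqP => [->|//]; rewrite (negbTE pl) !andbF.
have on_on l : p \in l ->
    points_on (p |` S1)%fset l = (p |` points_on S1 l)%fset.
  move=> pl; apply/fsetP => q; rewrite in_fset1U !in_points_on in_fset1U.
  by case: eqP => [->|//]; rewrite pl.
exists (p |` S1)%fset.
  split; first by rewrite cardfsU1 pS1 cS1 add1n.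
  apply/T_eq0 => [|l Ll]; first exact: ltnW.
  have [pl|pl] := boolP (p \in l).
    rewrite on_on// cardfsU1 (leq_ltn_trans _ r3)//.
    exact: leq_add (leq_b1 _) (hp _ Ll pl).
  by rewrite on_off//; move: l Ll {pl}; apply/T_eq0 => //; exact: ltnW.
apply: leq_trans tS1 _; apply: fsubset_leq_card; apply/fsubsetP => l.
rewrite !in_fset_set; try exact: finite_lines_meeting.
rewrite !inE => -[Ll cl]; split=> //; rewrite on_off//.
by apply/negP => pl; have := hp _ Ll pl; rewrite cl leqNgt k2.
Qed.

Lemma t_max_ge (R : realType) (k r n : nat) (S : {fset R * R}) :
  (2 <= k)%N -> (3 <= r)%N -> T r S = 0%N -> (#|` S| <= n)%N ->
  (t k S <= t_max R k r n)%N.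
Proof.
move=> k2 r3 TS cS; have [S' AS' tS] := add_generic_points k2 r3 TS cS.
by apply: leq_trans tS _; apply: (t_maxP R n k2 r3).2.
Qed.

(** * Spheres in parallel hyperplanes *)

(** Along the line, [|x + l y|^2 - |x|^2] is a quadratic polynomial in [l] with
    leading coefficient [|y|^2 != 0]; its only roots are then [0] and [1]. *)
Lemma sphere_no_three (R : realFieldType) (d : nat) (x y : 'rV[R]_d) (l : R) :
  y != 0 ->
  \sum_i (x + y) 0 i ^+ 2 = \sum_i x 0 i ^+ 2 ->
  \sum_i (x + l *: y) 0 i ^+ 2 = \sum_i x 0 i ^+ 2 ->
  l = 0 \/ l = 1.
Proof.
pose q := \sum_i y 0 i ^+ 2; pose m := \sum_i x 0 i * y 0 i.
have E c : \sum_i (x + c *: y) 0 i ^+ 2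
    = \sum_i x 0 i ^+ 2 + (c * (2 * m) + c ^+ 2 * q).
  rewrite /q /m !mulr_sumr -!big_split /=; apply: eq_bigr => i _.
  by rewrite !mxE; ring.
move=> y0; rewrite -{1}(scale1r y) !E => h1 h2.
have q0 : q != 0.
  apply: contraNneq y0 => q0; apply/eqP/rowP => i; rewrite mxE.
  move/eqP: q0; rewrite psumr_eq0 => [/allP/(_ i (mem_index_enum _))|j _].
    by rewrite /= sqrf_eq0 => /eqP.
  exact: sqr_ge0.
have /eqP : l * (l - 1) * q = 0.
  have m2 : 2 * m = - q by lra.
  have : l * (2 * m) + l ^+ 2 * q = 0 by lra.
  by rewrite m2 => <-; ring.
rewrite !mulf_eq0 (negbTE q0) orbF subr_eq0 => /orP[]/eqP; tauto.
Qed.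

(** The vector of dimension [d + 1] with first coordinate [h] followed by [v],
    encoded by its list of coefficients. *)
Definition pt (R : nzRingType) (d : nat) (h : R) (v : 'rV[R]_d) : {poly R} :=
  h%:P + 'X * rVpoly v.

Lemma pt_affine (R : comNzRingType) (d : nat) (h h' l : R) (v v' : 'rV[R]_d) :
  pt h v + l *: (pt h' v' - pt h v)
  = pt (h + l * (h' - h)) (v + l *: (v' - v)).
Proof.
rewrite /pt [rVpoly (v + _)]linearD linearZ /= [rVpoly (v' - _)]linearB /=.
by rewrite polyCD polyCM polyCB -!mul_polyC; ring.
Qed.

Lemma pt_inj (R : nzRingType) (d : nat) (h h' : R) (v v' : 'rV[R]_d) :
  pt h v = pt h' v' -> h = h' /\ v = v'.
Proof.
move=> /polyP e; split.
  by have := e 0%N; rewrite !coefD !coefC !coefXM /= !addr0.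
apply/rowP => i; have := e i.+1.
by rewrite !coefD !coefC !coefXM /= !add0r !coef_rVpoly_ord.
Qed.

Definition intvec (R : nzRingType) (d K : nat) (x : {ffun 'I_d -> 'I_K}) :
  'rV[R]_d := \row_i (x i)%:R.
Arguments intvec R {d K} x.

Lemma intvec_inj (R : numDomainType) (d K : nat) :
  injective (@intvec R d K).
Proof.
move=> x y /rowP e; apply/ffunP => i; apply/val_inj/eqP.
by have := e i; rewrite !mxE => /eqP; rewrite eqr_nat.
Qed.

Lemma intvec_sphere (R : nzRingType) (d K r : nat) (x : {ffun 'I_d -> 'I_K}) :
  (\sum_i x i ^ 2 = r)%N -> \sum_i intvec R x 0 i ^+ 2 = r%:R.
Proof.
by move=> <-; rewrite natr_sum; apply: eq_bigr => i _; rewrite mxE natrX.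
Qed.

(** The map [f] is a generic projection of the grid.  In the third property,
    [C] is the set of points of the spheres that [f] sends to [l]; the two
    alternatives correspond to a line crossing the slices and to a line inside
    one slice. *)
Lemma slices_of_spheres (R : realType) (N d K : nat) (r : 'I_N -> nat) :
  (3 <= N)%N ->
  exists f : 'I_N * {ffun 'I_d -> 'I_K} -> R * R,
  [/\ injective f,
      forall (g : 'I_N -> {ffun 'I_d -> 'I_K}) (a s : 'I_d -> nat),
        (forall t i, g t i = a i + t * s i :> nat)%N ->
        exists2 l, is_line l & forall t, f (t, g t) \in l &
      forall l, is_line l ->
        let C := [pred i : 'I_N * {ffun 'I_d -> 'I_K} |
          (\sum_j i.2 j ^ 2 == r i.1)%N && (f i \in l)] in
        {in C &, injective fst} \/ (#|C| <= 2)%N].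
Proof.
move=> N3; pose p (i : 'I_N * {ffun 'I_d -> 'I_K}) : {poly R} :=
  pt (i.1 : nat)%:R (intvec R i.2).
have p_inj : injective p.
  move=> [t x] [u y] /pt_inj /= [/eqP + /intvec_inj ->].
  by rewrite eqr_nat => /eqP/val_inj ->.
pose ps := [seq p i | i <- enum {: 'I_N * {ffun 'I_d -> 'I_K}}].
have pps i : p i \in ps by rewrite map_f// mem_enum.
have [xi [eta [ev_inj ev_col]]] := generic_projection ps.
pose f i : R * R := ((p i).[xi], (p i).[eta]).
have f_inj : injective f by move=> i j e; apply: p_inj; exact: ev_inj.
exists f; split=> // [g a s gE|l Ll C].
  pose i0 := Ordinal (ltn_trans (isT : 0 < 2)%N N3).
  pose i1 := Ordinal (ltn_trans (isT : 1 < 2)%N N3).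
  exists (line_through (f (i0, g i0)) (f (i1, g i1))).
    by apply: is_line_line_through; apply/eqP => /f_inj[].
  move=> t; rewrite inE.
  have pE : p (t, g t)
      = p (i0, g i0) + (t : nat)%:R *: (p (i1, g i1) - p (i0, g i0)).
    rewrite /p pt_affine /= add0r subr0 mulr1; congr pt.
    apply/rowP => i; rewrite !mxE !gE /= mul0n mul1n addn0 !natrD natrM.
    by ring.
  by rewrite /line_through /f /= pE !hornerE; ring.
(* Otherwise two points of the line share a height, and every other point of
   the line has this height too. *)
have [/dinjectiveP|] := boolP (dinjectiveb fst C); first by left.
move=> /dinjectivePn[i Ci [j]]; rewrite !inE => /andP[ji Cj] ij; right.
have pij : p i != p j by rewrite (inj_eq p_inj) eq_sym.
suff CP k : k \in C -> k \in [:: i; j].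
  apply: leq_trans (card_size [:: i; j]).
  by apply/subset_leq_card/fintype.subsetP.
rewrite !inE => Ck.
have /andP[/eqP si li] := Ci; have /andP[/eqP sj lj] := Cj.
have /andP[/eqP sk lk] := Ck; rewrite !inE in li lj lk.
have fij : f i != f j by rewrite (inj_eq f_inj) eq_sym.
move: lk; rewrite (line_through2 Ll li lj fij).
move=> /(ev_col _ _ _ (pps i) (pps j) (pps k) pij)[c].
rewrite /p pt_affine => /pt_inj[].
rewrite -ij subrr mulr0 addr0 => /eqP; rewrite eqr_nat => /eqP/val_inj ki vk.
have vij : intvec R j.2 - intvec R i.2 != 0.
  rewrite subr_eq0 (inj_eq (@intvec_inj R d K)).
  apply: contraNneq ji => e; apply/eqP.
  by rewrite (surjective_pairing j) (surjective_pairing i) ij e.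
have [||c0|c1] := sphere_no_three vij (x := intvec R i.2) (l := c).
- by rewrite addrC subrK (intvec_sphere R sj) (intvec_sphere R si) ij.
- by rewrite -vk (intvec_sphere R sk) (intvec_sphere R si) ki.
- move: vk; rewrite c0 scale0r addr0 => /intvec_inj k2.
  by rewrite (surjective_pairing k) ki k2 -surjective_pairing eqxx.
- move: vk; rewrite c1 scale1r addrC subrK => /intvec_inj k2.
  rewrite (surjective_pairing k) ki k2 ij -surjective_pairing.
  by rewrite eqxx orbT.
Qed.

(** * Many progressions with prescribed norms *)

Lemma pigeonhole (X Y : finType) (f : X -> Y) (x0 : X) :
  exists y, (#|X| <= #|Y| * #|[pred x | f x == y]|)%N.
Proof.
have [y _ ymax] := @arg_maxnP Y (f x0) xpredT
  (fun y => #|[pred x | f x == y]|) isT.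
exists y; rewrite -sum1_card (partition_big f xpredT)//=.
rewrite -sum_nat_const; apply: leq_sum => z _.
by rewrite sum1_card; exact: (ymax z).
Qed.

(** With [W = 2 V], each coordinate has [2 V ^ 2 * 32 V = 8 W ^ 3] choices of a
    first term and a step.  The quadratic moments [|a|^2], [a . s] and [|s|^2]
    are at most [d W ^ 4], so they take at most
    [(2 ^ d W ^ 4) ^ 3 = 8 ^ d W ^ 12] values, by the crude bound
    [d + 1 <= 2 ^ d]; the constant [32] is chosen for the resulting factor
    [8 ^ d] to cancel. *)
Lemma equinormal_progressions (V d : nat) : (8 <= V)%N ->
  exists (G : pred ({ffun 'I_d -> 'I_(2 * V ^ 2)} * {ffun 'I_d -> 'I_(32 * V)}))
         (r : nat -> nat),
    ((2 * V) ^ (3 * d) <= #|G| * (2 * V) ^ 12)%N /\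
    forall g t, G g -> (\sum_i (g.1 i + t * g.2 i) ^ 2 = r t)%N.
Proof.
move=> V8; set A := (2 * V ^ 2)%N; set B := (32 * V)%N.
have A0 : (0 < A)%N by rewrite /A muln_gt0 expn_gt0 /=; lia.
have B0 : (0 < B)%N by rewrite /B; lia.
pose E := ((2 * V) ^ 2)%N.
have AE : (A <= E)%N by rewrite /A /E expnMn leq_mul.
have BE : (B <= E)%N by rewrite /B /E expnMn expnS expn1 mulnA leq_mul2r; lia.
pose D := (d * E ^ 2)%N.
pose q (x : {ffun 'I_d -> 'I_A} * {ffun 'I_d -> 'I_B}) :=
  ((\sum_i x.1 i ^ 2)%N, (\sum_i x.1 i * x.2 i)%N, (\sum_i x.2 i ^ 2)%N).
have sumD (F : 'I_d -> nat) : (forall i, F i <= E ^ 2)%N -> (\sum_i F i <= D)%N.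
  move=> FE; apply: leq_trans (leq_sum _ (fun i _ => FE i)) _.
  by rewrite sum_nat_const card_ord.
have xE (x : {ffun 'I_d -> 'I_A} * {ffun 'I_d -> 'I_B}) i :
    (x.1 i <= E /\ x.2 i <= E)%N.
  by split; [apply: leq_trans AE|apply: leq_trans BE]; exact: ltnW.
pose f x : 'I_D.+1 * 'I_D.+1 * 'I_D.+1 :=
  (inord (q x).1.1, inord (q x).1.2, inord (q x).2).
have x0 : {ffun 'I_d -> 'I_A} * {ffun 'I_d -> 'I_B}.
  by exact: ([ffun=> Ordinal A0], [ffun=> Ordinal B0]).
have [[[u v] w] uvw] := pigeonhole f x0.
exists [pred x | f x == (u, v, w)], (fun t => u + 2 * t * v + t ^ 2 * w)%N.
split.
  move: uvw; set g := #|_|.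
  rewrite !card_prod !card_ffun !card_ord => h.
  have D2 : (D.+1 <= 2 ^ d * E ^ 2)%N.
    apply: (@leq_trans (d.+1 * E ^ 2)).
      by rewrite mulSn -add1n leq_add2r expn_gt0; lia.
    by rewrite leq_mul2r ltn_expl// orbT.
  rewrite -(leq_pmul2l (_ : 0 < 8 ^ d)%N) ?expn_gt0//.
  have -> : (8 ^ d * (2 * V) ^ (3 * d) = A ^ d * B ^ d)%N.
    by rewrite expnM -!expnMn; congr expn; rewrite /A /B; ring.
  apply: leq_trans h _.
  rewrite [leqRHS]mulnCA [leqLHS]mulnC leq_mul2l; apply/orP; right.
  have -> : (8 ^ d * (2 * V) ^ 12 = (2 ^ d * E ^ 2) ^ 3)%N.
    by rewrite [RHS]expnMn -[in RHS]expnM (mulnC d) expnM /E -!expnM.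
  by rewrite mulnn -expnSr leq_exp2r.
move=> g t /= /eqP [<- <- <-].
rewrite !inordK; last 3 first.
- by rewrite ltnS; apply: sumD => i; rewrite leq_exp2r//; apply (xE g i).
- by rewrite ltnS; apply: sumD => i; rewrite leq_mul//; apply (xE g i).
- by rewrite ltnS; apply: sumD => i; rewrite leq_exp2r//; apply (xE g i).
rewrite /q /= !big_distrr/= -!big_split /=; apply: eq_bigr => i _; ring.
Qed.

(** * The construction and its asymptotics *)

(** Distinct progressions span distinct lines, because a line with [N >= 3]
    points of the configuration has one in each slice, and the points at heights
    [0] and [1] determine the first term and the step. *)
Lemma many_rich_lines (R : realType) (N d : nat) : (3 <= N)%N ->
  exists S : {fset R * R},
    [/\ T N.+1 S = 0%N, (#|` S| <= (32 * N) ^ (2 * d.+1))%N &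
        ((32 * N) ^ (3 * d) <= t N S * (32 * N) ^ 12)%N].
Proof.
move=> N3; pose V := (16 * N)%N; pose K := ((2 * V) ^ 2)%N.
have -> : (32 * N = 2 * V)%N by rewrite /V mulnA.
have V8 : (8 <= V)%N by rewrite /V; lia.
have NV : (N <= 2 * V)%N by rewrite /V; lia.
have VK : (2 * V ^ 2 + N * (32 * V) = K)%N by rewrite /K /V; ring.
have [G [r [cardG Gr]]] := equinormal_progressions d V8.
have [f [f_inj f_prog f_line]] :=
  slices_of_spheres R d K (fun t : 'I_N => r t) N3.
pose B := [pred i : 'I_N * {ffun 'I_d -> 'I_K} | (\sum_j i.2 j ^ 2 == r i.1)%N].
pose S := [fset f i | i in B]%fset.
pose C (l : set (R * R)) := [pred i | B i && (f i \in l)].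
have cardS : #|` S| = #|B| by rewrite card_imfset//= -cardE.
have cardC l : #|` points_on S l| = #|C l|.
  have -> : points_on S l = [fset f i | i in C l]%fset.
    apply/fsetP => p; rewrite in_points_on; apply/andP/imfsetP.
      by move=> [/imfsetP[i /= Bi ->] fl]; exists i => //; apply/andP.
    by move=> [i /andP[Bi fl] ->]; split=> //; apply/imfsetP; exists i.
  by rewrite card_imfset//= -cardE.
have TS : T N.+1 S = 0%N.
  apply/T_eq0 => [|l Ll]; first by rewrite ltnS ltnW// ltnW.
  rewrite ltnS cardC; case: (f_line l Ll) => [inj|c2].
    rewrite -(card_in_image inj).
    by apply: leq_trans (max_card _) _; rewrite card_ord.
  by apply: leq_trans c2 _; exact: ltnW.
exists S; split=> //.
  rewrite cardS mulnS expnD; apply: leq_trans (max_card _) _.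
  rewrite card_prod card_ffun !card_ord /K -expnM leq_mul2r.
  apply/orP; right; apply: leq_trans NV _.
  by rewrite -mulnn leq_pmulr// muln_gt0 (leq_trans _ V8).
apply: leq_trans cardG _; rewrite leq_mul2r; apply/orP; right.
(* The progressions stay in the grid because [V = 16 N]: the [N] terms are
   below [2 V ^ 2 + N * 32 V = 4 V ^ 2 = K]. *)
have prog_lt (g : {ffun 'I_d -> 'I_(2 * V ^ 2)} * {ffun 'I_d -> 'I_(32 * V)})
    (t : 'I_N) i : (g.1 i + t * g.2 i < K)%N.
  have h1 := ltn_ord (g.1 i); have h2 := ltn_ord (g.2 i); have h3 := ltn_ord t.
  by rewrite -VK -addSn leq_add// leq_mul// ltnW.
pose prog g (t : 'I_N) : {ffun 'I_d -> 'I_K} :=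
  [ffun i => Ordinal (prog_lt g t i)].
have progE g t i : prog g t i = (g.1 i + t * g.2 i)%N :> nat by rewrite ffunE.
have progB g t : G g -> B (t, prog g t).
  move=> Gg; rewrite /B /= -(Gr _ t Gg); apply/eqP/eq_bigr => i _.
  by rewrite ffunE.
have exl g : exists l, is_line l /\ forall t, f (t, prog g t) \in l.
  have [l Ll fl] := f_prog (prog g) (g.1 : _ -> _) (g.2 : _ -> _) (progE g).
  by exists l.
have [L hL] := choice exl.
have CL g t : G g -> C (L g) (t, prog g t).
  by move=> Gg; apply/andP; split; [exact: progB|exact: (hL g).2].
have cardL g : G g -> (N <= #|C (L g)|)%N.
  move=> Gg; have inj : injective (fun t => (t, prog g t)) by move=> t u [].
  rewrite -{1}(card_ord N) -(card_codom inj).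
  apply/subset_leq_card/fintype.subsetP => _ /codomP[t ->]; exact: CL.
have L_inj : {in G &, injective L}.
  move=> g g' Gg Gg' e.
  have [inj|] := f_line _ (hL g).1; last first.
    by rewrite leqNgt (leq_trans N3 (cardL _ Gg)).
  have pE t : prog g t = prog g' t.
    have /inj : (t, prog g t) \in C (L g) by exact: CL.
    move=> /(_ (t, prog g' t)) h.
    have [//] : (t, prog g t) = (t, prog g' t).
    by apply: h => //; rewrite e; exact: CL.
  have pE' (t : 'I_N) i : (g.1 i + t * g.2 i = g'.1 i + t * g'.2 i :> nat)%N.
    by rewrite -!progE pE.
  have e1 i : g.1 i = g'.1 i :> nat.
    by have := pE' (Ordinal (ltn_trans (isT : 0 < 2)%N N3)) i; rewrite !addn0.
  have e2 i : g.2 i = g'.2 i :> nat.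
    have := pE' (Ordinal (ltn_trans (isT : 1 < 2)%N N3)) i.
    by rewrite e1 !mul1n => /addnI.
  rewrite (surjective_pairing g) (surjective_pairing g').
  by congr pair; apply/ffunP => i; apply: val_inj; [exact: e1|exact: e2].
have -> : #|G| = #|` [fset L g | g in G]%fset|.
  by rewrite card_in_imfset//= -cardE.
apply: fsubset_leq_card; apply/fsubsetP => _ /imfsetP[g /= Gg ->].
rewrite in_fset_set; last by apply: finite_lines_meeting; exact: ltnW.
rewrite inE; split; first exact: (hL g).1.
apply/eqP; rewrite eqn_leq cardC cardL// andbT -cardC -ltnS.
by move: {+}(L g) (hL g).1; apply/T_eq0; rewrite // ltnS ltnW// ltnW.
Qed.

Lemma t_max_sparse (R : realType) (N n d : nat) : (3 <= N)%N ->
  ((32 * N) ^ (2 * d.+1) <= n)%N ->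
  ((32 * N) ^ (3 * d) <= t_max R N N.+1 n * (32 * N) ^ 12)%N.
Proof.
move=> N3 dn; have [S [TS cS tS]] := many_rich_lines R d N3.
apply: leq_trans tS _; rewrite leq_mul2r; apply/orP; right.
by apply: t_max_ge => //; [exact: ltnW|exact: ltnW|exact: leq_trans cS dn].
Qed.

Lemma sqr_M_le (N : nat) : (5 <= N)%N -> (M N ^ 2 <= N ^ 3)%N.
Proof.
move=> N5; rewrite /M !inE.
case: ifP => [N11|_].
  have : (11 <= N)%N by lia.
  by nia.
by case: ifP => _; nia.
Qed.

Lemma tau_le (R : realType) (N : nat) : (5 <= N)%N -> tau R N <= 3 / 2.
Proof.
move=> N5; have lnN : 0 < ln (N%:R : R).
  by rewrite ln_gt0// ltr1n (leq_trans _ N5).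
have N0 : 0 < N%:R :> R by rewrite ltr0n (leq_trans _ N5).
have M0 : 0 < (M N)%:R :> R.
  by rewrite ltr0n /M; case: ifP => _; [|case: ifP => _]; lia.
rewrite /tau ler_pdivrMr//.
have : ln ((M N)%:R ^+ 2 : R) <= ln (N%:R ^+ 3).
  by rewrite ler_ln ?posrE ?exprn_gt0// -!natrX ler_nat sqr_M_le.
rewrite (lnXn 2 M0) (lnXn 3 N0).
by move: (ln _) (ln _) => a b h; lra.
Qed.

Theorem theorem1 (R : realType) (N : nat) (hN : (5 <= N)%N) :
  exists2 c : R, 0 < c &
    \forall n \near \oo, c * n%:R `^ tau R N <= (t_max R N N.+1 n)%:R.
Proof.
pose W := (32 * N)%N.
have W2 : (1 < W)%N by rewrite /W; lia.
have W0 : 0 < W%:R :> R by rewrite ltr0n; lia.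
(* With [n < W ^ (2 d + 4)] and [W ^ (3 d - 12)] lines, the quotient by
   [n ^ (3 / 2)] is at least [W ^ (3 d - 12) / W ^ (3 d + 6)]. *)
exists (W%:R ^- 18); first by rewrite invr_gt0 exprn_gt0.
exists (W ^ 2)%N => // n /= Wn.
have n0 : (0 < n)%N by apply: leq_trans Wn; rewrite expn_gt0; lia.
have WW : (1 < W ^ 2)%N by rewrite -(exp1n 2) ltn_exp2r.
have /andP[dn nd] := trunc_log_bounds WW n0.
(* The dimension is [d]: then [W ^ (2 d + 2) <= n < W ^ (2 d + 4)]. *)
case: (trunc_log _ _) dn nd => [|d]; first by rewrite expn1 ltnNge Wn.
rewrite -!expnM => dn nd.
have N3 : (3 <= N)%N by apply: leq_trans hN.
have {dn} := t_max_sparse R N3 dn; rewrite -/W; move: (t_max _ _ _ _) => m mW.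
rewrite ler_pdivrMl ?exprn_gt0//.
apply: (@le_trans _ _ (W%:R ^+ (3 * d.+2))).
  have -> : W%:R ^+ (3 * d.+2) = (W ^ (2 * d.+2))%:R `^ (3 / 2) :> R.
    rewrite natrX -!powR_mulrn ?ltW// -powRrM; congr powR.
    by rewrite !natrM; field.
  apply: (@le_trans _ _ (n%:R `^ (3 / 2))).
    by apply: ler_powR; [rewrite ler1n|exact: tau_le].
  by apply: ge0_ler_powR; rewrite ?nnegrE ?ler0n ?ler_nat ?(ltnW nd)//; lra.
rewrite -!natrX -natrM ler_nat.
have -> : (3 * d.+2 = 6 + 3 * d)%N by lia.
by rewrite expnD (expnD W 6 12) -mulnA leq_mul2l (mulnC _ m) mW orbT.
Qed.
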